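(* Let $q$ be a polynomial quartic differential on $\mathbb{C}$ and let $f:\mathbb{C}\to \mathrm{Gr}_2(\mathbb{R}^4)$ be the associated map $f(z)=T_z\,\mathrm{Span}(u_1(z),u_3(z))$ defined in the context. Then $f$ is a convex immersion.
   Context: Convexity. For a plane $L\subset\mathbb{R}^4$ identify $T_L\mathrm{Gr}_2(\mathbb{R}^4)=\mathrm{Hom}(L,\mathbb{R}^4/L)$. An immersion $f:\Sigma\to \mathrm{Gr}_2(\mathbb{R}^4)$ of a Riemann surface $\Sigma$ is convex if for every $p\in\Sigma$ and every nonzero $X\in T_p\Sigma$ the linear map $B(X)=d_pf(X)\in\mathrm{Hom}(f(p),\mathbb{R}^4/f(p))$ is invertible. The map $f$. Let $q=q(z)dz^4$ with $q(z)$ a complex polynomial, and write $\Delta=\partial_z\partial_{\bar z}$. There is a unique pair of smooth functions $U_1,U_2:\mathbb{C}\to\mathbb{R}$ with $\Delta U_1=e^{U_1-U_2}-e^{-2U_1}|q|^2$, $\Delta U_2=e^{2U_2}-e^{U_1-U_2}$, and $U_1-\frac34\log|q|$, $U_2-\frac14\log|q|$ bounded near infinity. Put $h_i=e^{-U_i}$, $H=\mathrm{diag}(h_1,h_2^{-1},h_1^{-1},h_2)$, $$\varphi=\begin{pmatrix}0&0&q&0\\0&0&0&1\\0&1&0&0\\1&0&0&0\end{pmatrix}dz,\qquad \varphi^{*H}=H^{-1}\overline{\varphi}^{\,t}H,$$ and let $\nabla=d+H^{-1}\partial H+\varphi+\varphi^{*H}$, a flat connection on $\mathcal{E}=\mathbb{C}\times\mathbb{C}^4$.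 With $Q=\begin{pmatrix}0&\mathrm{Id}\\ \mathrm{Id}&0\end{pmatrix}$ ($2\times2$ blocks), $\tau(v)=H^{-1}Q\bar v$ is a $\nabla$-parallel real structure; $\mathcal{E}_{\mathbb{R}}=\mathrm{Fix}(\tau)$ is a $\nabla$-parallel real rank 4 subbundle with the real frame $$u_1=\tfrac1{\sqrt2}(0,h_2^{1/2},0,h_2^{-1/2})^t,\quad u_2=\tfrac1{\sqrt2}(h_1^{-1/2},0,h_1^{1/2},0)^t,$$ $$u_3=\tfrac1{\sqrt2}(0,ih_2^{1/2},0,-ih_2^{-1/2})^t,\quad u_4=\tfrac1{\sqrt2}(ih_1^{-1/2},0,-ih_1^{1/2},0)^t .$$ $T_z:(\mathcal{E}_{\mathbb{R}})_z\to(\mathcal{E}_{\mathbb{R}})_0\cong\mathbb{R}^4$ denotes $\nabla$-parallel transport. *)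

(* Defs.v *)
From HB Require Import structures.
From mathcomp Require Import all_boot all_order all_algebra.
From mathcomp Require Import complex.
From mathcomp Require Import all_classical all_reals all_analysis.

Set Implicit Arguments.
Unset Strict Implicit.
Unset Printing Implicit Defensive.

Import Order.TTheory GRing.Theory Num.Theory.
Import numFieldNormedType.Exports.

Local Open Scope classical_set_scope.
Local Open Scope complex_scope.
Local Open Scope ring_scope.

(* The complex line as a real surface: the real pair (x, y) stands for
   x + iy, so that real differential calculus on normed spaces applies.
   Tangent vectors are elements of the same space. *)
Notation plane R := (R^o * R^o)%type.

Section PlaneCalculus.
Variable R : realType.
Implicit Types (z X : plane R) (A : set (plane R)).

Definition toC z : R[i] := z.1 +i* z.2.

Definition e_x : plane R := (1, 0).
Definition e_y : plane R := (0, 1).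

Fixpoint Ck_on (k : nat) A (g : plane R -> R^o) : Prop :=
  match k with
  | 0%N => forall z, A z -> {for z, continuous g}
  | k'.+1 => [/\ forall z, A z -> derivable g z e_x /\ derivable g z e_y,
                 Ck_on k' A ('D_(e_x) g) & Ck_on k' A ('D_(e_y) g)]
  end.

(* C^oo on A; only used for open sets A *)
Definition smooth_on A (g : plane R -> R^o) : Prop := forall k, Ck_on k A g.

Definition smooth_rV_on n A (s : plane R -> 'rV[R]_n) : Prop :=
  forall j, smooth_on A (fun z => s z 0 j).

Definition smooth_cV n (s : plane R -> 'cV[R[i]]_n) : Prop :=
  forall j, smooth_on setT (fun z => complex.Re (s z j 0)) /\
            smooth_on setT (fun z => complex.Im (s z j 0)).

Definition dirC X (g : plane R -> R[i]) z : R[i] :=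
  ('D_X (fun w => complex.Re (g w) : R^o) z)
    +i* ('D_X (fun w => complex.Im (g w) : R^o) z).

Definition d_z (g : plane R -> R[i]) z : R[i] :=
  2^-1 * (dirC e_x g z - 'i%C * dirC e_y g z).

Definition d_zbar (g : plane R -> R[i]) z : R[i] :=
  2^-1 * (dirC e_x g z + 'i%C * dirC e_y g z).

(* one quarter of the usual Laplacian *)
Definition Delta (U : plane R -> R) : plane R -> R[i] :=
  d_z (d_zbar (fun z => (U z)%:C)).

Definition bounded_near_infinity (g : plane R -> R) : Prop :=
  exists r M : R, forall z, r < Normc.normc (toC z) -> `|g z| <= M.

End PlaneCalculus.

(* The quotient V / L, realised on a complement of L, with the projection
   V -> V / L along L. *)
Section Quotient.
Variables (K : fieldType) (V : vectType K) (L : {vspace V}).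

Definition quotv : vectType K := subvs_of (L^C)%VS.

Definition quotv_proj : 'Hom(V, quotv) :=
  linfun (fun v => vsproj (L^C)%VS (daddv_pi (L^C)%VS L v)).

Let cap0 : (L^C :&: L = 0)%VS.
Proof. by rewrite capvC capv_compl. Qed.

Lemma quotv_projE v :
  quotv_proj v = vsproj (L^C)%VS (daddv_pi (L^C)%VS L v).
Proof.
have lin : linear (fun v => vsproj (L^C)%VS (daddv_pi (L^C)%VS L v) : quotv).
  by move=> a x y; rewrite !linearP.
pose m := GRing.isLinear.Build _ _ _ _ _ lin.
pose f : {linear V -> quotv} := HB.pack
  (fun v => vsproj (L^C)%VS (daddv_pi (L^C)%VS L v) : quotv) m.
exact: (lfunE f).
Qed.

Lemma lker_quotv_proj : lker quotv_proj = L.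
Proof.
apply/vspaceP => v; rewrite memv_ker quotv_projE.
have dec : daddv_pi (L^C)%VS L v + daddv_pi L (L^C)%VS v = v.
  by apply: daddv_pi_add => //; rewrite addvC addv_complf memvf.
apply/eqP/idP => [h|vL].
  have : daddv_pi (L^C)%VS L v = 0.
    by rewrite -[LHS](@vsprojK _ _ (L^C)%VS) ?memv_pi// h linear0.
  by move=> h0; rewrite -dec h0 add0r memv_pi.
have e : daddv_pi L (L^C)%VS v = v by rewrite daddv_pi_id// capv_compl.
by move/eqP: dec; rewrite e -subr_eq0 addrK => /eqP ->; rewrite linear0.
Qed.

Lemma quotv_proj_surj (w : quotv) : exists v, quotv_proj v = w.
Proof.
exists (vsval w); rewrite quotv_projE daddv_pi_id ?subvsP//.
exact: vsvalK.
Qed.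

End Quotient.

Section Grassmannian.
Variable R : realType.

Definition Gr2 := {L : {vspace 'rV[R]_4} | \dim L == 2%N}.

Implicit Types (f : plane R -> Gr2) (p X : plane R).

Definition smooth_Gr2 f : Prop :=
  forall p, exists (A : set (plane R)) (w1 w2 : plane R -> 'rV[R]_4),
    [/\ open A, A p, smooth_rV_on A w1, smooth_rV_on A w2 &
        forall z, A z -> val (f z) = <<[:: w1 z; w2 z]>>%VS].

Definition local_section f p (s : plane R -> 'rV[R]_4) : Prop :=
  exists A : set (plane R),
    [/\ open A, A p, smooth_rV_on A s & forall z, A z -> s z \in val (f z)].

(* d_p f (X) under the identification T_L Gr_2(R^4) = Hom(L, R^4 / L): it sends
   s(p) to D_X s (p) mod L for every local section s of the pulled-back
   tautological bundle, L = f(p).  This determines it when f is smooth. *)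
Definition dGr2 f p X : 'Hom(subvs_of (val (f p)), quotv (val (f p))) :=
  xget (0 : 'Hom(_, _)) [set B : 'Hom(_, _) | forall s, local_section f p s ->
    B (vsproj (val (f p)) (s p)) = quotv_proj (val (f p)) ('D_X s p)].

Definition immersion f : Prop :=
  smooth_Gr2 f /\ forall p, injective (dGr2 f p).

Definition convex_map f : Prop :=
  forall p X, X != 0 -> bijective (dGr2 f p X).

End Grassmannian.

Section HarmonicBundle.
Variables (R : realType) (q : {poly R[i]}) (U1 U2 : plane R -> R).
Implicit Types (z X : plane R) (v : 'cV[R[i]]_4).

(* ln 0 = 0 in the library; this is harmless because only large z matter and
   there is no solution when q = 0. *)
Definition toda_solution : Prop :=
  [/\ smooth_on setT U1 /\ smooth_on setT U2,
      forall z, Delta U1 z =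
        (expR (U1 z - U2 z)
         - expR (- 2 * U1 z) * Normc.normc q.[toC z] ^+ 2)%:C,
      forall z, Delta U2 z = (expR (2 * U2 z) - expR (U1 z - U2 z))%:C,
      bounded_near_infinity
        (fun z => U1 z - 3 / 4 * ln (Normc.normc q.[toC z])) &
      bounded_near_infinity
        (fun z => U2 z - 1 / 4 * ln (Normc.normc q.[toC z]))].

Definition h1 z : R := expR (- U1 z).
Definition h2 z : R := expR (- U2 z).

Definition Hmx z : 'M[R[i]]_4 :=
  diag_mx (\row_j nth 0 [:: (h1 z)%:C; (h2 z)^-1%:C; (h1 z)^-1%:C; (h2 z)%:C] j).

(* phi = Phi dz and phi^{*H} = PhiStar dzbar *)
Definition Phi z : 'M[R[i]]_4 :=
  \matrix_(i, j) nth 0 (nth [::]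
    [:: [:: 0; 0; q.[toC z]; 0];
        [:: 0; 0; 0;         1];
        [:: 0; 1; 0;         0];
        [:: 1; 0; 0;         0]] i) j.

Definition PhiStar z : 'M[R[i]]_4 :=
  invmx (Hmx z) *m (map_mx conjc (Phi z))^T *m Hmx z.

Definition d_zHmx z : 'M[R[i]]_4 :=
  \matrix_(i, j) d_z (fun w => Hmx w i j) z.

(* (nabla_X s)(z), where dz(X) = toC X and dzbar(X) is its conjugate *)
Definition nabla X (s : plane R -> 'cV[R[i]]_4) z : 'cV[R[i]]_4 :=
  \col_j dirC X (fun w => s w j 0) z
  + toC X *: ((invmx (Hmx z) *m d_zHmx z + Phi z) *m s z)
  + conjc (toC X) *: (PhiStar z *m s z).

Definition parallel (s : plane R -> 'cV[R[i]]_4) : Prop :=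
  smooth_cV s /\ forall X z, nabla X s z = 0.

Definition Qmx : 'M[R[i]]_(2 + 2) := block_mx 0 1%:M 1%:M 0.

Definition tau z v : 'cV[R[i]]_4 :=
  invmx (Hmx z) *m (Qmx *m map_mx conjc v).

Definition E_R z : set 'cV[R[i]]_4 := [set v | tau z v = v].

Definition u1 z : 'cV[R[i]]_4 := ((Num.sqrt 2)^-1)%:C *:
  \col_j nth 0 [:: 0; (h2 z `^ (1 / 2))%:C; 0; (h2 z `^ (- (1 / 2)))%:C] j.

Definition u3 z : 'cV[R[i]]_4 := ((Num.sqrt 2)^-1)%:C *:
  \col_j nth 0 [:: 0; 'i%C * (h2 z `^ (1 / 2))%:C;
                   0; - 'i%C * (h2 z `^ (- (1 / 2)))%:C] j.

Definition span_u13 z : set 'cV[R[i]]_4 :=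
  [set v | exists a b : R, v = a%:C *: u1 z + b%:C *: u3 z].

(* T z v is the value at 0 of the parallel section through v in (E_R)_z; the
   values of T z outside (E_R)_z are irrelevant. *)
Definition parallel_transport
    (T : plane R -> 'cV[R[i]]_4 -> 'cV[R[i]]_4) : Prop :=
  forall z v, E_R z v ->
    exists s, [/\ parallel s, s z = v & T z v = s 0].

Definition identification (psi : 'cV[R[i]]_4 -> 'rV[R]_4) : Prop :=
  set_bij (E_R 0) setT psi /\
  forall (a : R) v w, E_R 0 v -> E_R 0 w ->
    psi (a%:C *: v + w) = a *: psi v + psi w.

End HarmonicBundle.

(* Main.v *)
(* Let S_z x be the value at z of the parallel real section whose coordinates
   at 0 are x in R^4.  The span of u_1, u_3 is the set of real vectors whose first
   entry vanishes, so f(z) is the kernel of the real linear map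
   x |-> (S_z x)_1 from R^4 to C = R^2, and modulo f(p) the differential of f
   at p is x |-> - D_X (S x)_1 followed by the inverse of the induced isomorphism
   R^4 / f(p) = R^2.  For x in f(p) the equation nabla S x = 0 reduces to
   D_X (S x)_1 = - conj(dz X) (h_2 / h_1) (S_p x)_4, which vanishes only for
   X = 0 or x = 0.

   No uniqueness theorem for differential equations is needed.  The constant
   symplectic form om = e_1 /\ e_3 + e_2 /\ e_4 is parallel and T provides a
   parallel section through every real vector, so a parallel section vanishing
   at one point is om-orthogonal to a spanning set everywhere.  The form also
   expresses the coordinates of a vector linearly through the parallel
   frame, which gives a smooth frame of f. *)
Require Import Defs.
From mathcomp Require Import all_boot all_order all_algebra.
From mathcomp Require Import complex ring lra.
From mathcomp Require Import all_classical all_reals all_analysis.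

Set Implicit Arguments.
Unset Strict Implicit.
Unset Printing Implicit Defensive.

Import Order.TTheory GRing.Theory Num.Theory.
Import numFieldNormedType.Exports.

Local Open Scope classical_set_scope.
Local Open Scope complex_scope.
Local Open Scope ring_scope.

(** * Differential calculus on the plane *)

Section RealCalculus.
Variables (R : realType) (V : normedModType R).

(** The two difference quotients, of [g] in direction [e] and of its restriction to the line, are
    the same function of [h]. *)
Lemma is_derive_line (g : V -> R^o) (a e : V) (s : R) :
  derivable g (s *: e + a) e ->
  is_derive s (1 : R) (fun t : R => g (t *: e + a)) ('D_e g (s *: e + a)).
Proof.
move=> dg.
have E : (fun h : R => h^-1 *: (g ((h *: 1 + s) *: e + a) - g (s *: e + a))) =
         (fun h : R => h^-1 *: (g (h *: e + (s *: e + a)) - g (s *: e + a))).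
  by apply/funext => h; rewrite [_%:A]mulr1 scalerDl addrA.
by split; rewrite /derivable /derive /= E.
Qed.

(** Both signs of [t] are covered because increments tend to 0 from both sides; the bound on [s]
    keeps the intermediate point close to [a]. *)
Lemma MVT_line (g dg : V -> R^o) (a e : V) (t : R) :
  (forall s : R, `|s| <= `|t| -> is_derive (s *: e + a) e g (dg (s *: e + a))) ->
  exists2 s : R, `|s| <= `|t| & g (t *: e + a) - g a = t * dg (s *: e + a).
Proof.
move=> Dg; pose phi (s : R) := g (s *: e + a).
pose dphi (s : R) := dg (s *: e + a).
have phi0 : phi 0 = g a by rewrite /phi scale0r add0r.
have Dphi s : `|s| <= `|t| -> is_derive s (1 : R) phi (dphi s).
  by move=> /Dg[dge dgE]; rewrite /dphi -dgE; exact: is_derive_line.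
have Dphi1 s : `|s| <= `|t| -> derivable phi s 1.
  by move=> st; have [] := Dphi _ st.
have [t0|t0] := leP 0 t.
- have sub s : s \in `[0, t] -> `|s| <= `|t|.
    by rewrite in_itv/= => /andP[s0 st]; rewrite !ger0_norm.
  have [s|| s /sub st] := @MVT_segment R phi dphi 0 t t0.
  + by move/subset_itv_oo_cc/sub; exact: Dphi.
  + by apply: derivable_within_continuous => s /sub; exact: Dphi1.
  + by rewrite phi0 subr0 mulrC => E; exists s.
- have sub s : s \in `[t, 0] -> `|s| <= `|t|.
    rewrite in_itv/= => /andP[ts s0]; rewrite !ler0_norm ?lerN2//.
    exact: ltW.
  have [s|| s /sub st] := @MVT_segment R phi dphi t 0 (ltW t0).
  + by move/subset_itv_oo_cc/sub; exact: Dphi.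
  + by apply: derivable_within_continuous => s /sub; exact: Dphi1.
  + rewrite phi0 => E; exists s => //.
    by rewrite -opprB -/(phi t) E sub0r mulrN opprK mulrC.
Qed.

End RealCalculus.

Section PlaneDerivative.
Variable R : realType.
Implicit Types (z p X : plane R) (A : set (plane R)).

(** [Ck_on] controls only the two partial derivatives. The increment along [h *: X] is split into a
    horizontal step and a vertical step, the mean value theorem applies to each, and continuity of
    the partials at [p] moves the intermediate values to [p]. *)
Lemma C1_is_derive A (g gx gy : plane R -> R^o) p X : open A -> A p ->
  (forall z, A z -> is_derive z (e_x R) g (gx z)) ->
  (forall z, A z -> is_derive z (e_y R) g (gy z)) ->
  {for p, continuous gx} -> {for p, continuous gy} ->
  is_derive p X g (X.1 * gx p + X.2 * gy p).
Proof.
move=> oA Ap dgx dgy cx cy.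
suff cv : h^-1 *: (g (h *: X + p) - g p) @[h --> 0^'] -->
    (X.1 * gx p + X.2 * gy p : R^o).
  by split; [apply/cvg_ex; eexists; exact: cv | exact/cvg_lim].
apply/cvgrPdist_le => /= eps eps0.
pose C := `|X.1| + `|X.2|.
have C0 : 0 <= C by rewrite addr_ge0.
have C10 : 0 < C + 1 by rewrite ltr_wpDl.
(* Dividing by [C + 1] rather than [C] keeps the divisor positive when [X = 0]. *)
pose e1 := eps / (C + 1).
have e10 : 0 < e1 by rewrite divr_gt0.
have nA : nbhs p A by exact: open_nbhs_nbhs.
have /cvgrPdist_lt /(_ _ e10) nx := cx.
have /cvgrPdist_lt /(_ _ e10) ny := cy.
have /nbhs_ballP[d /= d0 dP] : nbhs p (A `&`
    ([set z | `|gx p - gx z| < e1] `&` [set z | `|gy p - gy z| < e1])).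
  exact: filterI nA (filterI nx ny).
have nex : `|e_x R| = 1 by rewrite prod_normE/= normr1 normr0 max_l.
have ney : `|e_y R| = 1 by rewrite prod_normE/= normr1 normr0 max_r.
near=> h.
have h0 : h != 0 by near: h; exact: nbhs_dnbhs_neq.
have hC : `|h| * C < d.
  have : `|h| < d / (C + 1) by near: h; apply: dnbhs0_lt; rewrite divr_gt0.
  rewrite ltr_pdivlMr// => /(le_lt_trans _); apply.
  by rewrite ler_wpM2l// lerDl.
(* Both segments of the broken path from [p] to [h *: X + p] stay in the ball on which the partials
   are controlled. *)
have near_p (s t : R) : `|s| <= `|h * X.1| -> `|t| <= `|h * X.2| ->
    ball p d (t *: e_y R + (s *: e_x R + p)).
  move=> sh th; rewrite -ball_normE /ball_/= distrC addrA addrK.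
  apply: le_lt_trans hC; apply: le_trans (ler_normD _ _) _.
  rewrite !normrZ nex ney !mulr1 /C mulrDr addrC -!normrM.
  exact: lerD.
have near_p1 (s : R) : `|s| <= `|h * X.1| -> ball p d (s *: e_x R + p).
  by move=> sh; have := near_p s 0 sh; rewrite scale0r add0r; apply; rewrite normr0.
have [s sh Es] : exists2 s : R, `|s| <= `|h * X.1| &
    g ((h * X.1) *: e_x R + p) - g p = (h * X.1) * gx (s *: e_x R + p).
  apply: MVT_line => s /near_p1/dP[As _]; exact: dgx.
have [t th Et] : exists2 t : R, `|t| <= `|h * X.2| &
    g ((h * X.2) *: e_y R + ((h * X.1) *: e_x R + p)) - g ((h * X.1) *: e_x R + p)
    = (h * X.2) * gy (t *: e_y R + ((h * X.1) *: e_x R + p)).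
  apply: MVT_line => t /(near_p _ _ (lexx _))/dP[At _]; exact: dgy.
have Xe : (h * X.2) *: e_y R + ((h * X.1) *: e_x R + p) = h *: X + p.
  rewrite addrA; congr (_ + _); rewrite [RHS]surjective_pairing/=.
  by apply: injective_projections; rewrite /= /GRing.scale/= ?mulr0 ?mulr1 ?addr0 ?add0r.
rewrite Xe in Et.
have [_ [/= wx _]] := dP _ (near_p1 _ sh).
have [_ [_ /= vy]] := dP _ (near_p _ _ (lexx _) th).
move: (gx p) (gy p) (gx (s *: e_x R + p))
  (gy (t *: e_y R + ((h * X.1) *: e_x R + p))) wx vy Es Et
  => a b a' b' wx vy Es Et.
have -> : h^-1 *: (g (h *: X + p) - g p) = X.1 * a' + X.2 * b' :> R.
  rewrite -[_ - _](subrKA (g ((h * X.1) *: e_x R + p))) Es Et.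
  rewrite /GRing.scale/=.
  by field.
have -> : X.1 * a + X.2 * b - (X.1 * a' + X.2 * b') =
  X.1 * (a - a') + X.2 * (b - b') :> R by ring.
apply: le_trans (ler_normD _ _) _; rewrite !normrM.
apply: (@le_trans _ _ (C * e1)).
  rewrite [C * e1]mulrDl; apply: lerD; apply: ler_wpM2l => //; exact: ltW.
by rewrite /e1 mulrA ler_pdivrMr// mulrC ler_wpM2l ?ltW// ltrDl.
Unshelve. all: by end_near. Qed.

Lemma smooth_is_derive A (g : plane R -> R^o) p X : open A -> A p ->
  smooth_on A g ->
  is_derive p X g (X.1 * 'D_(e_x R) g p + X.2 * 'D_(e_y R) g p).
Proof.
move=> oA Ap /(_ 1%N)[dg cx cy]; apply: (@C1_is_derive A g ('D_(e_x R) g) ('D_(e_y R) g) p X oA Ap).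
- by move=> z /dg[/derivableP].
- by move=> z /dg[_ /derivableP].
- exact: cx.
- exact: cy.
Qed.

(** On [setT] the derivative of the combination equals the combination of the derivatives as a
    function, so the induction hypothesis applies after rewriting. *)
Lemma Ck_on_setT_lin k (a b : R) (f g : plane R -> R^o) :
  Ck_on k setT f -> Ck_on k setT g ->
  Ck_on k setT (fun z => a * f z + b * g z : R^o).
Proof.
elim: k f g => [|k IH] f g /=.
  move=> cf cg z _; apply: cvgD; apply: cvgM; try exact: cvg_cst.
    exact: cf.
  exact: cg.
case=> df fx fy [dg gx gy].
have dl z e : derivable f z e -> derivable g z e ->
    is_derive z e (fun z => a * f z + b * g z : R^o) (a * 'D_e f z + b * 'D_e g z).
  move=> /derivableP dfz /derivableP dgz.
  have -> : (fun z => a * f z + b * g z : R^o) = a \*: f + b \*: g by [].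
  exact: is_deriveD.
have E e : (forall z, derivable f z e) -> (forall z, derivable g z e) ->
    'D_e (fun z => a * f z + b * g z : R^o) = (fun z => a * 'D_e f z + b * 'D_e g z).
  by move=> fe ge; apply/funext => z; have [] := dl z e (fe z) (ge z).
split.
- move=> z _; have [fzx fzy] := df z I; have [gzx gzy] := dg z I.
  by have [? _] := dl z _ fzx gzx; have [? _] := dl z _ fzy gzy.
- rewrite E; [exact: IH | | ] => z; [by have [] := df z I | by have [] := dg z I].
- rewrite E; [exact: IH | | ] => z; [by have [] := df z I | by have [] := dg z I].
Qed.

Lemma smooth_on_cst (c : R) : smooth_on setT (fun _ : plane R => c : R^o).
Proof.
move=> k; elim: k c => [|k IH] c /=; first by move=> z _; exact: cvg_cst.
have E e : 'D_e (fun _ : plane R => c : R^o) = (fun _ => 0).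
  by apply/funext => z; rewrite derive_cst.
by split; [move=> z _; split; exact: derivable_cst | rewrite E | rewrite E].
Qed.

Lemma smooth_on_lin (a b : R) (f g : plane R -> R^o) :
  smooth_on setT f -> smooth_on setT g ->
  smooth_on setT (fun z => a * f z + b * g z : R^o).
Proof. by move=> sf sg k; exact: Ck_on_setT_lin. Qed.

Lemma smooth_on_sum n (c : 'I_n -> R) (f : 'I_n -> plane R -> R^o) :
  (forall i, smooth_on setT (f i)) ->
  smooth_on setT (fun z => \sum_i f i z * c i : R^o).
Proof.
elim: n c f => [|n IH] c f sf.
  by under eq_fun do rewrite big_ord0; exact: smooth_on_cst.
under eq_fun do rewrite big_ord_recl /= mulrC -[X in _ + X]mul1r.
by apply: smooth_on_lin => //; apply: IH.
Qed.

End PlaneDerivative.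

(** * Directional derivatives of complex-valued functions *)

Section ComplexDerivative.
Variable R : realType.
Implicit Types (z X : plane R) (f g : plane R -> R[i]).

(** Unlike [dirC], this also asserts that the derivatives exist, so that sum and product rules can
    be chained. *)
Definition is_dirC X g z (d : R[i]) : Prop :=
  is_derive z X (fun w => complex.Re (g w) : R^o) (complex.Re d) /\
  is_derive z X (fun w => complex.Im (g w) : R^o) (complex.Im d).

Lemma is_dirC_cst X c z : is_dirC X (fun _ => c) z 0.
Proof. by split; exact: is_derive_cst. Qed.

Lemma is_dirCD X f g z df dg : is_dirC X f z df -> is_dirC X g z dg ->
  is_dirC X (fun w => f w + g w) z (df + dg).
Proof.
move=> [f1 f2] [g1 g2]; split.
  have -> : (fun w => complex.Re (f w + g w) : R^o) =
      (fun w => complex.Re (f w) : R^o) + (fun w => complex.Re (g w) : R^o).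
    by apply/funext => w; rewrite raddfD.
  by rewrite raddfD; exact: is_deriveD.
have -> : (fun w => complex.Im (f w + g w) : R^o) =
    (fun w => complex.Im (f w) : R^o) + (fun w => complex.Im (g w) : R^o).
  by apply/funext => w; rewrite raddfD.
by rewrite raddfD; exact: is_deriveD.
Qed.

Lemma is_dirCM X f g z df dg : is_dirC X f z df -> is_dirC X g z dg ->
  is_dirC X (fun w => f w * g w) z (df * g z + f z * dg).
Proof.
move=> [f1 f2] [g1 g2].
(* Real and imaginary part of a product both have the form [a * b + e * (c * d)], with [e = -1] and
   [e = 1]. *)
have rule (F a b c d : plane R -> R^o) (dF da db dc dd : R) (e : R) :
    is_derive z X a da -> is_derive z X b db ->
    is_derive z X c dc -> is_derive z X d dd ->
    (forall w, F w = a w * b w + e * (c w * d w)) ->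
    dF = a z * db + b z * da + e * (c z * dd + d z * dc) ->
    is_derive z X F dF.
  move=> a1 b1 c1 d1 EF ->.
  have -> : F = a * b + e \*: (c * d) by apply/funext.
  exact: is_deriveD.
split.
  apply: (@rule _ (fun w => complex.Re (f w)) (fun w => complex.Re (g w))
    (fun w => complex.Im (f w)) (fun w => complex.Im (g w)) _ _ _ _ _ (-1) f1 g1 f2 g2).
    by move=> w; case: (f w) (g w) => [a b] [c d] /=; ring.
  by case: df dg (f z) (g z) {f1 f2 g1 g2} => [a b] [c d] [a' b'] [c' d'] /=; ring.
apply: (@rule _ (fun w => complex.Re (f w)) (fun w => complex.Im (g w))
  (fun w => complex.Im (f w)) (fun w => complex.Re (g w)) _ _ _ _ _ 1 f1 g2 f2 g1).
  by move=> w; case: (f w) (g w) => [a b] [c d] /=; ring.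
by case: df dg (f z) (g z) {f1 f2 g1 g2} => [a b] [c d] [a' b'] [c' d'] /=; ring.
Qed.

Lemma is_dirCB X f g z df dg : is_dirC X f z df -> is_dirC X g z dg ->
  is_dirC X (fun w => f w - g w) z (df - dg).
Proof.
move=> [f1 f2] [g1 g2]; split.
  have -> : (fun w => complex.Re (f w - g w) : R^o) =
      (fun w => complex.Re (f w) : R^o) - (fun w => complex.Re (g w) : R^o).
    by apply/funext => w; rewrite raddfB.
  by rewrite raddfB; exact: is_deriveB.
have -> : (fun w => complex.Im (f w - g w) : R^o) =
    (fun w => complex.Im (f w) : R^o) - (fun w => complex.Im (g w) : R^o).
  by apply/funext => w; rewrite raddfB.
by rewrite raddfB; exact: is_deriveB.
Qed.

Lemma is_dirC_conj X f z df : is_dirC X f z df ->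
  is_dirC X (fun w => conjc (f w)) z (conjc df).
Proof.
move=> [f1 f2]; split.
  have -> : (fun w => complex.Re (conjc (f w)) : R^o) = (fun w => complex.Re (f w)).
    by apply/funext => w; case: (f w).
  by case: df f1 {f2}.
have -> : (fun w => complex.Im (conjc (f w)) : R^o) = - (fun w => complex.Im (f w) : R^o).
  by apply/funext => w; transitivity (- complex.Im (f w)) => //; case: (f w).
have -> : complex.Im (conjc df) = - complex.Im df by case: df {f1 f2}.
exact: is_deriveN.
Qed.

Lemma is_dirC_real X (u : plane R -> R^o) z du : is_derive z X u du ->
  is_dirC X (fun w => (u w)%:C) z du%:C.
Proof. by move=> d; split => //=; exact: is_derive_cst. Qed.

Lemma is_dirC_val X g z d : is_dirC X g z d -> dirC X g z = d.
Proof. by case=> -[_ e1] [_ e2]; rewrite /dirC e1 e2; case: d {e1 e2}. Qed.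

(** Along the segment from [z] to [w], real and imaginary part are functions of one real variable
    with zero derivative. *)
Lemma is_dirC0_const g : (forall X z, is_dirC X g z 0) -> forall z w, g z = g w.
Proof.
move=> g0 z w.
suff re (f : plane R -> R^o) : (forall X z, is_derive z X f 0) -> f z = f w.
  apply/eqP; rewrite eq_complex; apply/andP; split; apply/eqP.
    by apply: (re (fun w => complex.Re (g w))) => X y; case: (g0 X y).
  by apply: (re (fun w => complex.Im (g w))) => X y; case: (g0 X y).
move=> df; pose phi (t : R) : R := f (t *: (w - z) + z).
have -> : f z = phi 0 by rewrite /phi scale0r add0r.
have -> : f w = phi 1 by rewrite /phi scale1r subrK.
apply: is_derive_0_is_cst => t.
have [dt e] := df (w - z) (t *: (w - z) + z).
by have := is_derive_line dt; rewrite e.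
Qed.

End ComplexDerivative.

(** * The connection and its parallel symplectic form *)

Notation k0 := (@Ordinal 4 0 isT).
Notation k1 := (@Ordinal 4 1 isT).
Notation k2 := (@Ordinal 4 2 isT).
Notation k3 := (@Ordinal 4 3 isT).

Lemma sum_ord4 (V : nmodType) (F : 'I_4 -> V) :
  \sum_i F i = F k0 + F k1 + F k2 + F k3.
Proof.
rewrite !big_ord_recl big_ord0 addr0 !addrA.
by congr (_ + _ + _ + _); congr F; apply: val_inj.
Qed.

(** The equations are packed as a product in [Type] so that a single [rewrite] selects the matching
    one. *)
Lemma nth_ord4 (T : Type) (x a b c d : T) :
  ((nth x [:: a; b; c; d] k0 = a) * (nth x [:: a; b; c; d] k1 = b) *
   (nth x [:: a; b; c; d] k2 = c) * (nth x [:: a; b; c; d] k3 = d))%type.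
Proof. by []. Qed.

Lemma ord4_ind (P : 'I_4 -> Prop) : P k0 -> P k1 -> P k2 -> P k3 -> forall j, P j.
Proof.
move=> p0 p1 p2 p3 [[|[|[|[|//]]]] lt_j4]; by [
  rewrite (_ : Ordinal _ = k0) //; apply: val_inj |
  rewrite (_ : Ordinal _ = k1) //; apply: val_inj |
  rewrite (_ : Ordinal _ = k2) //; apply: val_inj |
  rewrite (_ : Ordinal _ = k3) //; apply: val_inj ].
Qed.

Lemma invmx_diag (F : fieldType) n (d : 'rV[F]_n) :
  (forall j, d 0 j != 0) -> invmx (diag_mx d) = diag_mx (map_mx GRing.inv d).
Proof.
move=> d0; set E := diag_mx (map_mx _ _).
have DE : diag_mx d *m E = 1%:M.
  apply/matrixP => i j; rewrite mul_diag_mx !mxE mulrnAr.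
  by case: eqP => // _; rewrite mulfV.
by have [uD _] := mulmx1_unit DE; rewrite -[RHS](mulKmx uD) DE mulmx1.
Qed.

Lemma mul_diag_cVE (F : fieldType) n (d : 'rV[F]_n) (v : 'cV[F]_n) i :
  (diag_mx d *m v) i 0 = d 0 i * v i 0.
Proof. by rewrite mul_diag_mx mxE. Qed.

Lemma cV_linE (K : pzRingType) n (c : K) (A B : 'cV[K]_n) j :
  (c *: A + B) j 0 = c * A j 0 + B j 0.
Proof. by rewrite !mxE. Qed.

Section Conjugation.
Variable R : realType.
Implicit Types x y : R[i].

Lemma conjcD x y : conjc (x + y) = conjc x + conjc y. Proof. exact: rmorphD. Qed.
Lemma conjcN x : conjc (- x) = - conjc x. Proof. exact: rmorphN. Qed.
Lemma conjcM x y : conjc (x * y) = conjc x * conjc y. Proof. exact: rmorphM. Qed.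
Lemma conjcV x : conjc x^-1 = (conjc x)^-1. Proof. exact: fmorphV. Qed.
Lemma conjcX x n : conjc (x ^+ n) = conjc x ^+ n. Proof. exact: rmorphXn. Qed.

Definition conjcE := (conjcD, conjcN, conjcM, conjcV, conjcX, @conjcK R).

Lemma is_dirC_eq (X : plane R) g (z : plane R) d d' :
  d' = d -> is_dirC X g z d -> is_dirC X g z d'.
Proof. by move=> ->. Qed.

End Conjugation.

Section Exponential.
Variables (R : realType) (V : normedModType R).

(** Restriction to the line through [z] in direction [X] reduces this to the chain rule in one
    variable. *)
Lemma is_derive_expRM (u : V -> R^o) (c : R) z X du : is_derive z X u du ->
  is_derive z X (fun w => expR (c * u w) : R^o) (c * du * expR (c * u z)).
Proof.
move=> [dv uE].
have dl : derivable u (0 *: X + z) X by rewrite scale0r add0r.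
have := is_derive_line dl; rewrite scale0r add0r uE => d0.
pose phi (t : R) : R := u (t *: X + z).
have dcphi : is_derive (0 : R) (1 : R) (c \*: phi : R -> R) (c * du).
  exact: is_deriveZ.
have dphi : is_derive (0 : R) (1 : R) (expR \o (c \*: phi)) (c * du * expR (c * u z)).
  apply: is_derive_eq.
  by rewrite /= /phi scale0r add0r mulrC.
have E : (fun h : R => h^-1 *: ((expR \o (c \*: phi)) (h *: (1:R) + 0) - (expR \o (c \*: phi)) 0) : R^o) =
    (fun h : R => h^-1 *: ((fun w => expR (c * u w)) (h *: X + z) - expR (c * u z)) : R^o).
  by apply/funext => h; rewrite /= /phi [_%:A]mulr1 addr0 scale0r add0r.
case: dphi; rewrite /derivable /derive => d1 d2.
by split; rewrite /derivable /derive -E.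
Qed.

End Exponential.

Definition h1C (R : realType) (U1 : plane R -> R) z : R[i] := (h1 U1 z)%:C.
Definition h2C (R : realType) (U2 : plane R -> R) z : R[i] := (h2 U2 z)%:C.

Section Connection.
Variables (R : realType) (q : {poly R[i]}) (U1 U2 : plane R -> R).
Hypotheses (sU1 : smooth_on setT U1) (sU2 : smooth_on setT U2).
Implicit Types (z X : plane R) (v : 'cV[R[i]]_4) (s t : plane R -> 'cV[R[i]]_4).

Local Notation H1 := (h1C U1).
Local Notation H2 := (h2C U2).

Definition dzU (U : plane R -> R) z : R[i] := d_z (fun w => (U w)%:C) z.

Lemma h1_neq0 z : H1 z != 0.
Proof. by rewrite /h1C fmorph_eq0 gt_eqF// expR_gt0. Qed.

Lemma h2_neq0 z : H2 z != 0.
Proof. by rewrite /h2C fmorph_eq0 gt_eqF// expR_gt0. Qed.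

Lemma conjH1 z : conjc (H1 z) = H1 z.
Proof. exact: conjc_real. Qed.

Lemma conjH2 z : conjc (H2 z) = H2 z.
Proof. exact: conjc_real. Qed.

(** For real [U] the two Wirtinger derivatives are conjugate, so dU(X) is [toC X * dzU U z] plus its
    conjugate; the rest is the chain rule. *)
Lemma smooth_dirC (U : plane R -> R) c z X : smooth_on setT U ->
  is_dirC X (fun w => (expR (c * U w))%:C) z
    (c%:C * (toC X * dzU U z + conjc (toC X * dzU U z)) * (expR (c * U z))%:C).
Proof.
move=> sU; have dU := smooth_is_derive X openT (I : setT z) sU.
have := is_dirC_real (is_derive_expRM c dU).
rewrite !rmorphM/=; congr (is_dirC _ _ _ (_ * _ * _)).
rewrite /dzU /d_z /dirC /toC /=.
have -> : (fun w => complex.Re (U w)%:C : R^o) = U by [].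
have -> : (fun w => complex.Im (U w)%:C : R^o) = (fun=> 0) by [].
rewrite !derive_cst; move: ('D_(e_x R) U z) ('D_(e_y R) U z) => a b.
have -> : (2^-1 : R[i]) = (2^-1)%:C by rewrite fmorphV/= rmorph_nat.
by case: X {dU} => x y; simpc; congr (_ +i* _); field.
Qed.

(** The directions [e_x] and [e_y] have [toC] equal to 1 and i; in the combination defining [d_z]
    the conjugate terms cancel because i squared is -1. *)
Lemma d_z_exp (U : plane R -> R) c z : smooth_on setT U ->
  d_z (fun w => (expR (c * U w))%:C) z = c%:C * dzU U z * (expR (c * U z))%:C.
Proof.
move=> sU; rewrite {1}/d_z !(is_dirC_val (smooth_dirC _ _ _ sU)).
have -> : toC (e_x R) = 1 by [].
have -> : toC (e_y R) = 'i%C by [].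
move: (dzU U z) (expR _)%:C c%:C => d e k.
have c1 : conjc 1 = 1 :> R[i] by exact: rmorph1.
have ci : conjc 'i%C = - 'i%C :> R[i] by simpc.
have cM (x y : R[i]) : conjc (x * y) = conjc x * conjc y by exact: rmorphM.
rewrite !cM ?c1 ?ci {c1 ci}.
have i2 : 'i%C * 'i%C = - 1 :> R[i] by simpc.
have -> : 2^-1 * (k * (1 * d + 1 * conjc d) * e -
    'i%C * (k * ('i%C * d + - 'i%C * conjc d) * e)) =
  2^-1 * (k * (d + conjc d) * e - 'i%C * 'i%C * (k * (d - conjc d) * e)) by ring.
by rewrite i2; field.
Qed.

(* The zeroth order part of nabla. *)
Definition conn X z v : 'cV[R[i]]_4 :=
  toC X *: ((invmx (Hmx U1 U2 z) *m d_zHmx U1 U2 z + Phi q z) *m v)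
  + conjc (toC X) *: (PhiStar q U1 U2 z *m v).

Definition Hrow z : 'rV[R[i]]_4 :=
  \row_j nth 0 [:: H1 z; (H2 z)^-1; (H1 z)^-1; H2 z] j.

Lemma HmxE z : Hmx U1 U2 z = diag_mx (Hrow z).
Proof.
rewrite /Hmx; congr diag_mx; apply/rowP; elim/ord4_ind; rewrite !mxE !nth_ord4;
  [by [] | exact: fmorphV | exact: fmorphV | by []].
Qed.

Lemma Hrow_neq0 z j : Hrow z 0 j != 0.
Proof.
by elim/ord4_ind: j; rewrite mxE nth_ord4;
  [exact: h1_neq0 | rewrite invr_eq0; exact: h2_neq0 |
   rewrite invr_eq0; exact: h1_neq0 | exact: h2_neq0].
Qed.

Lemma d_zHmxE z : d_zHmx U1 U2 z = diag_mx (\row_j nth 0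
  [:: - dzU U1 z * H1 z; dzU U2 z * (H2 z)^-1; dzU U1 z * (H1 z)^-1; - dzU U2 z * H2 z] j).
Proof.
have E (U : plane R -> R) w : expR (- U w) = expR (-1 * U w) by rewrite mulN1r.
have EV (U : plane R -> R) w : (expR (- U w))^-1 = expR (1 * U w).
  by rewrite -expRN opprK mul1r.
have dE U : smooth_on setT U -> d_z (fun w => (expR (- U w))%:C) z =
    - dzU U z * (expR (- U z))%:C.
  move=> sU; under eq_fun do rewrite E.
  by rewrite d_z_exp// -E (_ : (-1)%:C = -1) ?mulN1r// rmorphN rmorph1.
have dEV U : smooth_on setT U -> d_z (fun w => (expR (- U w))^-1%:C) z =
    dzU U z * ((expR (- U z))%:C)^-1.
  move=> sU; under eq_fun do rewrite EV.
  by rewrite d_z_exp// -fmorphV/= (EV U z) (_ : 1%:C = 1) ?mul1r// rmorph1.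
have d0 : d_z (fun _ : plane R => 0 : R[i]) z = 0.
  by rewrite /d_z !(is_dirC_val (is_dirC_cst _ _ _)) mulr0 subr0 mulr0.
apply/matrixP => i j; rewrite mxE [RHS]mxE.
have [<-{j}|ij] := eqVneq i j; last first.
  rewrite mulr0n -[RHS]d0; congr (d_z _ z).
  by apply/funext => w; rewrite mxE (negbTE ij) mulr0n.
rewrite mulr1n mxE.
have -> : (fun w => Hmx U1 U2 w i i) = (fun w => nth 0 [:: (h1 U1 w)%:C;
    (h2 U2 w)^-1%:C; (h1 U1 w)^-1%:C; (h2 U2 w)%:C] i).
  by apply/funext => w; rewrite !mxE eqxx mulr1n.
elim/ord4_ind: i; rewrite !nth_ord4;
  under eq_fun do rewrite nth_ord4; [exact: dE | exact: dEV | exact: dEV | exact: dE].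
Qed.

(** The diagonal terms are the logarithmic derivatives of the entries of [Hmx]. The dzbar part of
    the first row involves only the entry [k3], with the nowhere vanishing coefficient
    [H2 z / H1 z]; convexity rests on this. *)
Lemma connE X z v (Z := toC X) (a := dzU U1 z) (b := dzU U2 z) :
  [/\ conn X z v k0 0 =
        Z * (- a * v k0 0 + q.[toC z] * v k2 0) + conjc Z * (H2 z / H1 z * v k3 0),
      conn X z v k1 0 =
        Z * (b * v k1 0 + v k3 0) + conjc Z * (H2 z / H1 z * v k2 0),
      conn X z v k2 0 =
        Z * (a * v k2 0 + v k1 0) + conjc Z * (conjc q.[toC z] * H1 z ^+ 2 * v k0 0) &
      conn X z v k3 0 =
        Z * (- b * v k3 0 + v k0 0) + conjc Z * ((H2 z)^-2 * v k1 0)].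
Proof.
have h10 := h1_neq0 z; have h20 := h2_neq0 z.
rewrite /conn /PhiStar d_zHmxE HmxE (invmx_diag (Hrow_neq0 z)) mulmxDl.
rewrite -!mulmxA.
set e := (\row_j _ : 'rV_4); set d := Hrow z; set di := map_mx _ d.
have entry j : (toC X *: (diag_mx di *m (diag_mx e *m v) + Phi q z *m v) +
    conjc (toC X) *: (diag_mx di *m ((map_mx conjc (Phi q z))^T *m (diag_mx d *m v)))) j 0 =
  Z * ((d 0 j)^-1 * (e 0 j * v j 0) + \sum_k Phi q z j k * v k 0) +
  conjc Z * ((d 0 j)^-1 * \sum_k conjc (Phi q z k j) * (d 0 k * v k 0)).
  have scE (c c' : R[i]) (A B C : 'cV[R[i]]_4) :
      (c *: (A + B) + c' *: C) j 0 = c * (A j 0 + B j 0) + c' * C j 0.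
    by rewrite !mxE.
  rewrite scE !mul_diag_cVE [di 0 j]mxE [(Phi q z *m v) j 0]mxE.
  rewrite [((map_mx conjc (Phi q z))^T *m _) j 0]mxE.
  congr (_ + _ * (_ * _)); apply: eq_bigr => k _.
  by rewrite mul_diag_cVE !mxE.
have c1 : conjc 1 = 1 :> R[i] by exact: rmorph1.
have c0 : conjc 0 = 0 :> R[i] by exact: rmorph0.
split; rewrite entry {entry} !sum_ord4 /Phi !mxE;
  rewrite !nth_ord4 ?c0 ?c1 ?mul0r ?mul1r ?addr0 ?add0r.
all: rewrite ?invrK /Z /a /b; move: (H1 z) (H2 z) h10 h20 (dzU U1 z) (dzU U2 z) => e1 e2 h10 h20 x y; by field; rewrite ?h10 ?h20.
Qed.

Lemma conn_linear X z (c : R[i]) v (w : 'cV[R[i]]_4) :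
  conn X z (c *: v + w) = c *: conn X z v + conn X z w.
Proof.
have connM x : conn X z x = (toC X *: (invmx (Hmx U1 U2 z) *m d_zHmx U1 U2 z + Phi q z)
    + conjc (toC X) *: PhiStar q U1 U2 z) *m x.
  by rewrite mulmxDl -!scalemxAl.
by rewrite !connM mulmxDr -scalemxAr.
Qed.

(** The parallel equation, entry by entry and with existence of derivatives included; in this form
    it passes easily to linear combinations and to [tau]. *)
Definition flat s : Prop := forall X z j,
  is_dirC X (fun w => s w j 0) z (- conn X z (s z) j 0).

Lemma parallel_flat s : parallel q U1 U2 s -> flat s.
Proof.
move=> [sm ds] X z j; have [sr si] := sm j.
have [dr _] := smooth_is_derive X openT (I : setT z) sr.
have [di _] := smooth_is_derive X openT (I : setT z) si.
have -> : - conn X z (s z) j 0 = dirC X (fun w => s w j 0) z.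
  have /matrixP/(_ j 0) := ds X z; rewrite /nabla -addrA -/(conn X z (s z)).
  move: (conn X z (s z)) => A; rewrite mxE [X in X + _]mxE [RHS]mxE.
  by move/eqP; rewrite addr_eq0 => /eqP ->.
by split; [exact: derivableP dr | exact: derivableP di].
Qed.

Lemma flat_linear (c : R[i]) s t : flat s -> flat t ->
  flat (fun z => c *: s z + t z).
Proof.
move=> fs ft X z j.
have -> : - conn X z (c *: s z + t z) j 0 =
    0 * s z j 0 + c * - conn X z (s z) j 0 + - conn X z (t z) j 0.
  by rewrite conn_linear cV_linE; move: (conn X z (s z)) (conn X z (t z)) => A B; ring.
have -> : (fun w => (c *: s w + t w) j 0) = (fun w => c * s w j 0 + t w j 0).
  by apply/funext => w; rewrite cV_linE.
by apply: is_dirCD (is_dirCM _ _) _; [exact: is_dirC_cst | exact: fs | exact: ft].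
Qed.

Lemma flat_sum n (c : 'I_n -> R[i]) (s : 'I_n -> plane R -> 'cV[R[i]]_4) :
  (forall i, flat (s i)) -> flat (fun z => \sum_i c i *: s i z).
Proof.
elim: n c s => [|n IH] c s fs.
  under eq_fun do rewrite big_ord0.
  move=> X z j; rewrite [X in conn _ _ X](_ : _ = 0 *: 0 + 0); last by rewrite scaler0 addr0.
  rewrite conn_linear scale0r add0r.
  have : conn X z 0 = 0.
    by have := conn_linear X z 1 0 0; rewrite !scale1r addr0 => /eqP; rewrite -subr_eq0 opprD addrA subrr sub0r oppr_eq0 => /eqP.
  by move=> ->; rewrite mxE oppr0; exact: is_dirC_cst.
under eq_fun do rewrite big_ord_recl.
by apply: flat_linear => //; apply: IH.
Qed.

Definition om v (w : 'cV[R[i]]_4) : R[i] :=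
  v k0 0 * w k2 0 - v k2 0 * w k0 0 + (v k1 0 * w k3 0 - v k3 0 * w k1 0).

(** The connection matrices lie in the symplectic Lie algebra of [om]: the diagonal terms are
    opposite within the pairs ([k0], [k2]) and ([k1], [k3]), and the terms of [Phi] and [PhiStar]
    cancel by symmetry. *)
Lemma om_conn X z v (w : 'cV[R[i]]_4) : om (conn X z v) w + om v (conn X z w) = 0.
Proof.
have := connE X z v; have := connE X z w.
move: (conn X z v) (conn X z w) => cv cw [w0 w1 w2 w3] [v0 v1 v2 v3].
rewrite /om v0 v1 v2 v3 w0 w1 w2 w3.
move: (toC X) (dzU U1 z) (dzU U2 z) q.[toC z] (H1 z) (H2 z) => Z a b c x y.
move: (conjc Z) (conjc c) (v k0 0) (v k1 0) (v k2 0) (v k3 0) => ? ? ? ? ? ?.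
by ring.
Qed.

Lemma om_flat s t : flat s -> flat t -> forall z z1, om (s z) (t z) = om (s z1) (t z1).
Proof.
move=> fs ft; apply: is_dirC0_const => X z.
have -> : 0 = - conn X z (s z) k0 0 * t z k2 0 + s z k0 0 * - conn X z (t z) k2 0
  - (- conn X z (s z) k2 0 * t z k0 0 + s z k2 0 * - conn X z (t z) k0 0)
  + (- conn X z (s z) k1 0 * t z k3 0 + s z k1 0 * - conn X z (t z) k3 0
  - (- conn X z (s z) k3 0 * t z k1 0 + s z k3 0 * - conn X z (t z) k1 0)).
  rewrite -[LHS]oppr0 -(om_conn X z (s z) (t z)) /om.
  by move: (conn X z (s z)) (conn X z (t z)) => A B; ring.
by apply: is_dirCD; apply: is_dirCB; (apply: is_dirCM; [exact: fs | exact: ft]).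
Qed.

Lemma om_linear (c : R[i]) (v v' w : 'cV[R[i]]_4) : om (c *: v + v') w = c * om v w + om v' w.
Proof. by rewrite /om !cV_linE; ring. Qed.

(** * The real structure and its compatibility with the connection *)

Lemma Qmx_entry (i j : 'I_4) : Qmx R i j = (((i + 2) %% 4)%N == j :> nat)%:R.
Proof.
rewrite /Qmx /block_mx mxE; case: splitP => i' ->; rewrite mxE; case: splitP => j' ->;
  rewrite !mxE; move: i' j' => [[|[|//]] ?] [[|[|//]] ?]; by [].
Qed.

Lemma tauE z v :
  [/\ tau U1 U2 z v k0 0 = (H1 z)^-1 * conjc (v k2 0),
      tau U1 U2 z v k1 0 = H2 z * conjc (v k3 0),
      tau U1 U2 z v k2 0 = H1 z * conjc (v k0 0) &
      tau U1 U2 z v k3 0 = (H2 z)^-1 * conjc (v k1 0)].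
Proof.
have QE (i : 'I_4) : (Qmx R *m map_mx conjc v) i 0 =
    \sum_(j < 4) (((i + 2) %% 4)%N == j :> nat)%:R * conjc (v j 0).
  by rewrite mxE; apply: eq_bigr => j _; rewrite Qmx_entry mxE.
rewrite /tau HmxE (invmx_diag (Hrow_neq0 z)).
set w := Qmx R *m _ in QE *.
have wE : [/\ w k0 0 = conjc (v k2 0), w k1 0 = conjc (v k3 0),
    w k2 0 = conjc (v k0 0) & w k3 0 = conjc (v k1 0)].
  split; rewrite QE sum_ord4.
  - by rewrite !mul0r mul1r !addr0 !add0r.
  - by rewrite !mul0r mul1r !add0r.
  - by rewrite !mul0r mul1r !addr0.
  - by rewrite !mul0r mul1r !addr0 !add0r.
case: wE => w0 w1 w2 w3.
split; rewrite mul_diag_cVE mxE mxE nth_ord4.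
- by rewrite w0.
- by rewrite w1 invrK.
- by rewrite w2 invrK.
- by rewrite w3.
Qed.

(** Of the four entries of [tau z v = v], those at [k0] and [k3] are equivalent to those at [k2] and
    [k1] by conjugation. *)
Lemma E_RP z v : E_R U1 U2 z v <->
  v k2 0 = H1 z * conjc (v k0 0) /\ v k1 0 = H2 z * conjc (v k3 0).
Proof.
have [t0 t1 t2 t3] := tauE z v; rewrite /E_R /=; split=> [tv|[v2 v1]].
  by rewrite tv in t1 t2.
apply/colP; elim/ord4_ind.
- by rewrite t0 v2 conjcM conjH1 conjcK mulKf ?h1_neq0.
- by rewrite t1 -v1.
- by rewrite t2 -v2.
- by rewrite t3 v1 conjcM conjH2 conjcK mulKf ?h2_neq0.
Qed.

Lemma is_dirC_exp (U : plane R -> R) X z : smooth_on setT U ->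
  let D := toC X * dzU U z in let E w := (expR (- U w))%:C in
  is_dirC X E z (- (D + conjc D) * E z) /\
  is_dirC X (fun w => (E w)^-1) z ((D + conjc D) / E z).
Proof.
move=> sU D E.
have EN : E = fun w => (expR (-1 * U w))%:C.
  by apply/funext => w; rewrite mulN1r.
have EV : (fun w => (E w)^-1) = fun w => (expR (1 * U w))%:C.
  by apply/funext => w; rewrite -fmorphV/= -expRN opprK mul1r.
split.
  have := smooth_dirC (-1) z X sU; rewrite -EN; apply: is_dirC_eq.
  have -> : (-1)%:C = -1 :> R[i] by rewrite rmorphN rmorph1.
  by rewrite mulN1r (_ : (expR _)%:C = E z) // EN.
have := smooth_dirC 1 z X sU; rewrite -EV; apply: is_dirC_eq.
have -> : 1%:C = 1 :> R[i] by rewrite rmorph1.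
by rewrite mul1r (_ : (expR _)%:C = (E z)^-1) // -[RHS]/((fun w => (E w)^-1) z) EV.
Qed.

(** Conjugation exchanges the dz and dzbar terms, and the swap of entries weighted by [Hmx]
    exchanges [Phi] with [PhiStar]; differentiating the weights restores the diagonal terms. *)
Lemma flat_tau s : flat s -> flat (fun z => tau U1 U2 z (s z)).
Proof.
move=> fs X z; have [d1 d1V] :
    is_dirC X H1 z (- (toC X * dzU U1 z + conjc (toC X * dzU U1 z)) * H1 z) /\
    is_dirC X (fun w => (H1 w)^-1) z
      ((toC X * dzU U1 z + conjc (toC X * dzU U1 z)) / H1 z) :=
  is_dirC_exp X z sU1.
have [d2 d2V] :
    is_dirC X H2 z (- (toC X * dzU U2 z + conjc (toC X * dzU U2 z)) * H2 z) /\
    is_dirC X (fun w => (H2 w)^-1) z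
      ((toC X * dzU U2 z + conjc (toC X * dzU U2 z)) / H2 z) :=
  is_dirC_exp X z sU2.
have h10 := h1_neq0 z; have h20 := h2_neq0 z.
have [c0 c1 c2 c3] := connE X z (s z).
have [C0 C1 C2 C3] := connE X z (tau U1 U2 z (s z)).
have [t0 t1 t2 t3] := tauE z (s z).
have fE j : (fun w => tau U1 U2 w (s w) j 0) = (fun w => nth 0
    [:: (H1 w)^-1 * conjc (s w k2 0); H2 w * conjc (s w k3 0);
        H1 w * conjc (s w k0 0); (H2 w)^-1 * conjc (s w k1 0)] j).
  apply/funext => w; have [? ? ? ?] := tauE w (s w).
  by elim/ord4_ind: j; rewrite nth_ord4.
have conjs j := is_dirC_conj (fs X z j).
elim/ord4_ind; rewrite fE; under eq_fun do rewrite nth_ord4.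
- rewrite C0 t0 t2 t3; apply: is_dirC_eq (is_dirCM d1V (conjs k2)); rewrite c2.
  move: (H1 z) (H2 z) h10 h20 (conjH1 z) (conjH2 z) => a b h10 h20 ca cb.
  move: (dzU U1 z) (dzU U2 z) q.[toC z] (toC X) => A B Q Z.
  rewrite !conjcE ?ca ?cb.
  move: (conjc A) (conjc B) (conjc Q) (conjc Z) => A' B' Q' Z'.
  by field; rewrite ?h10 ?h20.
- rewrite C1 t1 t2 t3; apply: is_dirC_eq (is_dirCM d2 (conjs k3)); rewrite c3.
  move: (H1 z) (H2 z) h10 h20 (conjH1 z) (conjH2 z) => a b h10 h20 ca cb.
  move: (dzU U1 z) (dzU U2 z) q.[toC z] (toC X) => A B Q Z.
  rewrite !conjcE ?ca ?cb.
  move: (conjc A) (conjc B) (conjc Q) (conjc Z) => A' B' Q' Z'.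
  by field; rewrite ?h10 ?h20.
- rewrite C2 t0 t1 t2; apply: is_dirC_eq (is_dirCM d1 (conjs k0)); rewrite c0.
  move: (H1 z) (H2 z) h10 h20 (conjH1 z) (conjH2 z) => a b h10 h20 ca cb.
  move: (dzU U1 z) (dzU U2 z) q.[toC z] (toC X) => A B Q Z.
  rewrite !conjcE ?ca ?cb.
  move: (conjc A) (conjc B) (conjc Q) (conjc Z) => A' B' Q' Z'.
  by field; rewrite ?h10 ?h20.
- rewrite C3 t0 t1 t3; apply: is_dirC_eq (is_dirCM d2V (conjs k1)); rewrite c1.
  move: (H1 z) (H2 z) h10 h20 (conjH1 z) (conjH2 z) => a b h10 h20 ca cb.
  move: (dzU U1 z) (dzU U2 z) q.[toC z] (toC X) => A B Q Z.
  rewrite !conjcE ?ca ?cb.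
  move: (conjc A) (conjc B) (conjc Q) (conjc Z) => A' B' Q' Z'.
  by field; rewrite ?h10 ?h20.
Qed.

End Connection.

(** * Kernel bundles in the Grassmannian *)

Lemma quotv_projP (K : fieldType) (V : vectType K) (L : {vspace V}) u v :
  quotv_proj L u = quotv_proj L v <-> u - v \in L.
Proof.
have uvE : (u - v \in L) = (quotv_proj L u - quotv_proj L v == 0).
  by rewrite -linearB -memv_ker lker_quotv_proj.
by rewrite uvE subr_eq0; split => [->|/eqP].
Qed.

Section KernelBundle.
Variables (R : realType) (M : plane R -> 'M[R]_(4, 2)).
Variables (w1 w2 : plane R -> 'rV[R]_4).
Implicit Types (z p X : plane R) (x : 'rV[R]_4).

Definition dmx p X : 'M[R]_(4, 2) :=
  \matrix_(i, k) 'D_X (fun z => M z i k : R^o) p.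

Hypothesis sM : forall i k, smooth_on setT (fun z => M z i k : R^o).
Hypothesis fM : forall z, row_full (M z).
Hypotheses (sw1 : smooth_rV_on setT w1) (sw2 : smooth_rV_on setT w2).
Hypothesis kerM : forall z x,
  x *m M z = 0 <-> exists a b : R, x = a *: w1 z + b *: w2 z.
(** Up to sign and the isomorphism of R^4 / f(p) with R^2 induced by [M p], this is injectivity of
    d_p f(X) on f(p) for nonzero [X]. *)
Hypothesis dM_inj : forall p X x,
  x *m M p = 0 -> x *m dmx p X = 0 -> x = 0 \/ X = 0.

Definition kerv z : {vspace 'rV[R]_4} := lker (linfun (mulmxr (M z))).

Lemma mem_kerv z x : (x \in kerv z) = (x *m M z == 0).
Proof. by rewrite memv_ker lfunE. Qed.

Lemma dim_kerv z : \dim (kerv z) == 2%N.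
Proof.
rewrite /kerv; set f : 'Hom('rV[R]_4, 'rV[R]_2) := linfun _.
have := limg_ker_dim f fullv; rewrite capfv.
have -> : limg f = fullv.
  apply/vspaceP => u; rewrite memvf.
  have <- : f (u *m pinvmx (M z)) = u.
    by rewrite /f lfunE /= mulmxKpV// submx_full.
  by rewrite memv_img ?memvf.
have d4 : \dim {: 'rV[R]_4} = 4%N by rewrite dimvf dim_matrix.
have d2 : \dim {: 'rV[R]_2} = 2%N by rewrite dimvf dim_matrix.
by rewrite d4 d2 => /eqP; rewrite -[4%N]/(2 + 2)%N eqn_add2r.
Qed.

Definition kerGr z : Gr2 R := exist _ (kerv z) (dim_kerv z).

Lemma dmx_is_derive p X i k :
  is_derive p X (fun z => M z i k : R^o) (dmx p X i k).
Proof.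
by rewrite mxE; apply: derivableP; have [] := smooth_is_derive X openT (I : setT p) (sM i k).
Qed.

Lemma dmx_linear p X Y : dmx p (X - Y) = dmx p X - dmx p Y.
Proof.
apply/matrixP => i k; rewrite !mxE.
have dE Z : 'D_Z (fun z => M z i k : R^o) p =
    Z.1 * 'D_(e_x R) (fun z => M z i k : R^o) p +
    Z.2 * 'D_(e_y R) (fun z => M z i k : R^o) p.
  exact: @derive_val (smooth_is_derive Z openT (I : setT p) (sM i k)).
rewrite (dE (X - Y)) (dE X) (dE Y).
move: ('D_(e_x R) _ p) ('D_(e_y R) _ p) => a b.
rewrite [(X - Y).1]/(X.1 - Y.1) [(X - Y).2]/(X.2 - Y.2).
move: X.1 Y.1 X.2 Y.2 => x1 y1 x2 y2.
by rewrite !mulrBl opprD addrACA.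
Qed.

(** The product rule applied to [s z *m M z = 0], which holds on a neighbourhood of [p]. *)
Lemma local_section_derive p X s : local_section kerGr p s ->
  'D_X s p *m M p = - (s p *m dmx p X).
Proof.
move=> [A [oA Ap sA sk]].
have ds j : is_derive p X (fun z => s z 0 j : R^o) ('D_X (fun z => s z 0 j : R^o) p).
  by apply: derivableP; have [] := smooth_is_derive X oA Ap (sA j).
have dsX : 'D_X s p = \row_j 'D_X (fun z => s z 0 j : R^o) p.
  rewrite derive_mx; last first.
    by apply/derivable_mxP => i j; rewrite ord1; have [] := ds j.
  by apply/matrixP => i j; rewrite !mxE ord1.
apply/eqP; rewrite -addr_eq0; apply/eqP/rowP => k; rewrite !mxE.
pose h j z : R^o := s z 0 j * M z j k.
have dh j : is_derive p X (h j) (s p 0 j * dmx p X j k + M p j k * ('D_X s p) 0 j).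
  by rewrite dsX [(\row_j _) 0 j]mxE; exact: is_deriveM (ds j) (dmx_is_derive p X j k).
have dG := @is_derive_sum _ _ _ _ _ _ _ _ dh.
have G0 : 'D_X (\sum_j h j) p = 0.
  rewrite -[RHS](derive_cst (0 : R^o) p X); apply: near_eq_derive.
  near=> z; have Az : A z by near: z; exact: open_nbhs_nbhs.
  have := sk _ Az; rewrite /= mem_kerv => /eqP/rowP/(_ k); rewrite !mxE => <-.
  by rewrite fct_sumE.
have := @derive_val _ _ _ _ _ _ _ dG; rewrite G0 big_split/= => /esym E.
rewrite -[RHS]E addrC; congr (_ + _); apply: eq_bigr => j _.
by rewrite mulrC.
Unshelve. all: by end_near. Qed.

Lemma mem_kerGr z x : (x \in val (kerGr z)) = (x *m M z == 0).
Proof. exact: mem_kerv. Qed.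

(** The point is that the set in the definition of [dGr2] is inhabited, so that [xget] does not
    return its default 0. *)
Lemma dGr2_kerE p X s : local_section kerGr p s ->
  dGr2 kerGr p X (vsproj (val (kerGr p)) (s p)) =
  quotv_proj (val (kerGr p)) ('D_X s p).
Proof.
move: s; rewrite /dGr2.
set P := [set B : 'Hom(_, _) | _]; rewrite -/(P _).
(* The witness sends [x] to the class of [- x *m dmx p X *m pinvmx (M p)]. By full rank, [M p] maps
   this vector and the derivative of any section through [x] to the same value, so they agree modulo
   f(p). *)
case: xgetP => [B _ //|] /(_ (quotv_proj (val (kerGr p)) \o
  linfun (mulmxr (- (dmx p X *m pinvmx (M p)))) \o linfun vsval)%VF) [].
move=> s ls; rewrite !comp_lfunE !lfunE /=.
have [A [_ Ap _ /(_ _ Ap) sp]] := ls.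
rewrite vsprojK//; apply/quotv_projP.
rewrite mem_kerGr mulmxBl local_section_derive//.
by rewrite mulmxN mulNmx [s p *m (_ *m _)]mulmxA mulmxKpV ?submx_full// opprK addNr.
Qed.

Lemma kerGr_section p x : x \in val (kerGr p) ->
  exists2 s, local_section kerGr p s & s p = x.
Proof.
rewrite mem_kerGr => /eqP/kerM[a [b ->]].
exists (fun z => a *: w1 z + b *: w2 z) => //.
exists setT; split=> //; first exact: openT.
- move=> j; rewrite (_ : (fun z => _) = fun z => a * w1 z 0 j + b * w2 z 0 j).
    by apply: smooth_on_lin; [exact: sw1 | exact: sw2].
  by apply/funext => z; rewrite !mxE.
- by move=> z _; rewrite mem_kerGr; apply/eqP/kerM; exists a, b.
Qed.

(** Right multiplication by [M p] is well defined modulo f(p) and, by [local_section_derive],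
    recovers [x *m dmx p X] from the differential. *)
Lemma dGr2_kerP p X Y x : x \in val (kerGr p) ->
  dGr2 kerGr p X (vsproj (val (kerGr p)) x) =
    dGr2 kerGr p Y (vsproj (val (kerGr p)) x) ->
  x *m dmx p X = x *m dmx p Y.
Proof.
move=> /kerGr_section[s ls sx].
have EX := dGr2_kerE X ls; have EY := dGr2_kerE Y ls; rewrite sx in EX EY.
move=> XY; have /quotv_projP := etrans (esym EX) (etrans XY EY).
rewrite mem_kerGr mulmxBl.
rewrite (local_section_derive X ls) (local_section_derive Y ls) sx.
by rewrite subr_eq0 eqr_opp => /eqP.
Qed.

Lemma dmx0 p : dmx p 0 = 0.
Proof. by rewrite -(subrr 0) dmx_linear subrr. Qed.

Lemma dGr2_ker0 p x : x \in val (kerGr p) ->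
  dGr2 kerGr p 0 (vsproj (val (kerGr p)) x) = 0.
Proof.
move=> /kerGr_section[s ls sx].
by have := dGr2_kerE 0 ls; rewrite sx derive0 linear0.
Qed.

Lemma dGr2_ker_inj p X (x : subvs_of (val (kerGr p))) : X != 0 ->
  dGr2 kerGr p X x = 0 -> x = 0.
Proof.
move=> X0 Bx; have xp : vsval x \in val (kerGr p) := subvsP x.
have : vsval x *m dmx p X = vsval x *m dmx p 0.
  exact: dGr2_kerP xp
    (etrans (etrans (congr1 (dGr2 kerGr p X) (vsvalK x)) Bx) (esym (dGr2_ker0 xp))).
rewrite dmx0 mulmx0 => /dM_inj[|x0|X00].
- by apply/eqP; rewrite -mem_kerGr.
- by apply: val_inj; rewrite /= x0.
- by rewrite X00 eqxx in X0.
Qed.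

Lemma kerGr_convex : immersion kerGr /\ convex_map kerGr.
Proof.
split; first split.
- move=> p; exists setT, w1, w2; split => //; first exact: openT.
  move=> z _; apply/vspaceP => x; rewrite /= mem_kerv.
  rewrite span_cons span_seq1; apply/eqP/memv_addP => [/kerM[a [b ->]]|].
    by exists (a *: w1 z); rewrite ?memvZ ?memv_line//; exists (b *: w2 z);
      rewrite ?memvZ ?memv_line.
  move=> [_ /vlineP[a ->] [_ /vlineP[b ->] ->]].
  by apply/kerM; exists a, b.
- move=> p X Y XY; pose L := val (kerGr p).
  (* One nonzero vector of f(p) suffices to separate [X] from [Y], since [dM_inj] applies to the
     difference [X - Y]. *)
  have [x xp x0] : exists2 x, x \in L & x != 0.
    exists (vpick L); first exact: memv_pick.
    by rewrite vpick0 -dimv_eq0 (eqP (dim_kerv p)).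
  have E : x *m dmx p X = x *m dmx p Y by apply: (dGr2_kerP xp); rewrite XY.
  have [x00|/eqP] : x = 0 \/ X - Y = 0.
    apply: (@dM_inj p); first by apply/eqP; rewrite -mem_kerGr.
    by rewrite dmx_linear mulmxBr E subrr.
  + by rewrite x00 eqxx in x0.
  + by rewrite subr_eq0 => /eqP.
- move=> p X X0.
  have := @dGr2_ker_inj p X ^~ X0; move: (dGr2 kerGr p X).
  have : \dim (val (kerGr p)) == 2%N := dim_kerv p.
  move: (val (kerGr p)) => L dL B Binj.
  have B0 : lker B == 0%VS.
    by rewrite -subv0; apply/subvP => x; rewrite memv_ker memv0 => /eqP/Binj ->.
  (* Both [L] and the quotient have dimension 2, so injectivity forces surjectivity. *)
  have Bsurj : limg B = fullv.
    apply/eqP; rewrite eqEdim subvf /=.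
    rewrite limg_dim_eq ?(eqP B0) ?capv0//.
    have -> : \dim {: subvs_of L} = \dim L by rewrite dimvf.
    have -> : \dim {: quotv L} = \dim (L^C)%VS by rewrite dimvf.
    by rewrite dimv_compl (eqP dL) dimvf dim_matrix.
  exists (B^-1)%VF; first exact: lker0_lfunK.
  by move=> y; apply: limg_lfunVK; rewrite Bsurj memvf.
Qed.

End KernelBundle.

(** * Parallel real sections *)

Section RealSections.
Variables (R : realType) (q : {poly R[i]}) (U1 U2 : plane R -> R).
Hypotheses (sU1 : smooth_on setT U1) (sU2 : smooth_on setT U2).
Implicit Types (z X : plane R) (v : 'cV[R[i]]_4) (s t : plane R -> 'cV[R[i]]_4).

Local Notation H1 := (h1C U1).
Local Notation H2 := (h2C U2).

(** The real vector with first two entries [a] and [b]: by [E_RP] these are free and determine the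
    others. *)
Definition realv z (a b : R[i]) : 'cV[R[i]]_4 :=
  \col_j nth 0 [:: a; b; H1 z * conjc a; (H2 z)^-1 * conjc b] j.

Lemma realvE z a b : ((realv z a b k0 0 = a) * (realv z a b k1 0 = b) *
  (realv z a b k2 0 = (H1 z * conjc a)%R) *
  (realv z a b k3 0 = ((H2 z)^-1 * conjc b)%R))%type.
Proof. by rewrite !mxE !nth_ord4. Qed.

Lemma realv_E_R z a b : E_R U1 U2 z (realv z a b).
Proof.
apply/E_RP; rewrite !realvE; split => //.
by rewrite conjcM conjcV conjcK conjH2 mulrA mulfV ?mul1r ?h2_neq0.
Qed.

Lemma E_R_realv z v : E_R U1 U2 z v -> v = realv z (v k0 0) (v k1 0).
Proof.
move=> /E_RP[v2 v1]; apply/colP; elim/ord4_ind; rewrite realvE //.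
by rewrite v1 conjcM conjcK conjH2 mulKf ?h2_neq0.
Qed.

Lemma E_R_linear z (c : R) v (w : 'cV[R[i]]_4) :
  E_R U1 U2 z v -> E_R U1 U2 z w -> E_R U1 U2 z (c%:C *: v + w).
Proof.
move=> /E_RP[v2 v1] /E_RP[w2 w1]; apply/E_RP; rewrite !cV_linE v2 v1 w2 w1.
by rewrite !conjcD !conjcM !conjc_real; split; ring.
Qed.

(* Test against the real vectors with (w_1, w_2) = (1, 0), (i, 0), (0, 1), (0, i). *)
Lemma om_nondeg z v : (forall w, E_R U1 U2 z w -> om v w = 0) -> v = 0.
Proof.
move=> v0; have T a b := v0 _ (realv_E_R z a b).
have c1 : conjc 1 = 1 :> R[i] by exact: rmorph1.
have c0 : conjc 0 = 0 :> R[i] by exact: rmorph0.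
have ci : conjc 'i%C = - 'i%C :> R[i] by simpc.
have i0 : 'i%C != 0 :> R[i] by rewrite eq_complex /= oner_eq0 andbF.
have := T 1 0; have := T 'i%C 0; have := T 0 1; have := T 0 'i%C.
rewrite /om !realvE c1 c0 ci.
have h10 : H1 z != 0 := h1_neq0 U1 z; have h20 : H2 z != 0 := h2_neq0 U2 z.
move=> e1 e2 e3 e4.
(* Testing with 1 and with i gives the difference and i times the sum of the same two terms, since
   conjugation changes the sign of i. *)
have ker2 (x y : R[i]) : x - y = 0 -> 'i%C * (x + y) = 0 -> x = 0.
  move=> /eqP; rewrite subr_eq0 => /eqP ->.
  by move/eqP; rewrite -mulr2n mulf_eq0 (negbTE i0) mulrn_eq0 => /eqP.
have z0 : v k0 0 * H1 z = 0.
  by apply: (@ker2 _ (v k2 0)); [rewrite -[RHS]e4 | rewrite -[RHS]oppr0 -[in RHS]e3]; ring.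
have z1 : v k1 0 / H2 z = 0.
  by apply: (@ker2 _ (v k3 0)); [rewrite -[RHS]e2 | rewrite -[RHS]oppr0 -[in RHS]e1]; ring.
have zz0 : v k0 0 = 0 by move/eqP: z0; rewrite mulf_eq0 (negbTE h10) orbF => /eqP.
have zz1 : v k1 0 = 0 by move/eqP: z1; rewrite mulf_eq0 invr_eq0 (negbTE h20) orbF => /eqP.
apply/colP; elim/ord4_ind; rewrite [RHS]mxE //.
- by apply/eqP; rewrite -oppr_eq0 -[X in _ == X]e4 zz0 zz1; apply/eqP; ring.
- by apply/eqP; rewrite -oppr_eq0 -[X in _ == X]e2 zz0 zz1; apply/eqP; ring.
Qed.

Hypothesis flat_through : forall z v, E_R U1 U2 z v ->
  exists2 s, flat q U1 U2 s & s z = v.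

Lemma flat_eq0 s z : flat q U1 U2 s -> s z = 0 -> forall z1, s z1 = 0.
Proof.
move=> fs s0 z1; apply: (@om_nondeg z1) => w /flat_through[t ft <-].
rewrite (om_flat sU1 sU2 fs ft z1 z) s0 /om !mxE.
by rewrite !mul0r subrr addr0.
Qed.

Lemma flat_eq s t z : flat q U1 U2 s -> flat q U1 U2 t -> s z = t z ->
  forall z1, s z1 = t z1.
Proof.
move=> fs ft st z1; have fd := flat_linear (-1) ft fs.
have := @flat_eq0 _ z fd; rewrite st scaleN1r addNr => /(_ erefl z1).
by rewrite scaleN1r addrC => /eqP; rewrite subr_eq0 => /eqP.
Qed.

(** The sections [s] and [tau s] are both flat and agree at [z], hence everywhere. *)
Lemma flat_E_R s z : flat q U1 U2 s -> E_R U1 U2 z (s z) ->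
  forall z1, E_R U1 U2 z1 (s z1).
Proof. by move=> fs sz z1; apply: (flat_eq (flat_tau sU1 sU2 fs) fs sz). Qed.

Lemma conj_om z v (w : 'cV[R[i]]_4) : E_R U1 U2 z v -> E_R U1 U2 z w ->
  conjc (om v w) = - om v w.
Proof.
move=> /E_RP[v2 v1] /E_RP[w2 w1]; rewrite /om v2 v1 w2 w1 !conjcE conjH1 conjH2.
by ring.
Qed.

(** The combination of [u1] and [u3] with coefficients [a], [b] is the real vector with first entry
    0 and second entry a + ib times the square root of h_2 / 2, a nonzero factor. *)
Lemma span_u13P z v : span_u13 U2 z v <-> E_R U1 U2 z v /\ v k0 0 = 0.
Proof.
have r0 : 0 < h2 U2 z by exact: expR_gt0.
pose r : R := h2 U2 z `^ (1 / 2).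
have rp : 0 < r by exact: powR_gt0.
have rr : r * r = h2 U2 z.
  rewrite /r -powRD ?gt_eqF ?implybT//.
  by rewrite (_ : 1 / 2 + 1 / 2 = 1) ?powRr1 ?ltW//; field.
pose k : R := (Num.sqrt 2)^-1.
have k00 : k != 0 by rewrite invr_eq0 sqrtr_eq0 -ltNge ltr0n.
have u1E : u1 U2 z = \col_j nth 0 [:: 0; k%:C * r%:C; 0; k%:C * (r^-1)%:C] j.
  apply/colP; elim/ord4_ind; rewrite !mxE !nth_ord4 ?mulr0//.
  by rewrite powRN.
have u3E : u3 U2 z = \col_j nth 0 [:: 0; 'i%C * (k%:C * r%:C); 0; - 'i%C * (k%:C * (r^-1)%:C)] j.
  apply/colP; elim/ord4_ind; rewrite !mxE !nth_ord4 ?mulr0//.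
    by rewrite mulrCA.
  by rewrite powRN mulrCA.
have lin2E (c d : R[i]) (A B : 'cV[R[i]]_4) j :
    (c *: A + d *: B) j 0 = c * A j 0 + d * B j 0.
  by rewrite !mxE.
have spanE a b : a%:C *: u1 U2 z + b%:C *: u3 U2 z = realv z 0 ((a +i* b) * (k * r)%:C).
  have abE : a +i* b = a%:C + 'i%C * b%:C by simpc.
  rewrite u1E u3E; apply/colP; elim/ord4_ind; rewrite realvE lin2E !mxE !nth_ord4.
  - by rewrite !mulr0 addr0.
  - by rewrite abE rmorphM /=; ring.
  - by rewrite !mulr0 addr0 [conjc 0]rmorph0 mulr0.
  - have cab : conjc (a +i* b) = a%:C - 'i%C * b%:C by simpc.
    have rV : (r^-1)%:C = (r%:C)^-1 :> R[i] by exact: fmorphV.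
    have rC : r%:C != 0 :> R[i] by rewrite fmorph_eq0 gt_eqF.
    have cM (x y : R) : (x * y)%:C = x%:C * y%:C by exact: rmorphM.
    rewrite conjcM conjc_real cab /h2C -rr !cM rV.
    by move: (k%:C) (r%:C) rC => x y y0; field.
split=> [[a [b ->]]|[vE v0]].
  by rewrite spanE; split; [exact: realv_E_R | rewrite realvE].
have kr0 : (k * r)%:C != 0 :> R[i] by rewrite fmorph_eq0 mulf_neq0// gt_eqF.
pose c := v k1 0 / (k * r)%:C.
exists (complex.Re c), (complex.Im c); rewrite spanE.
have -> : complex.Re c +i* complex.Im c = c by case: c.
by rewrite divfK// -v0 -(E_R_realv vE).
Qed.

End RealSections.

(** * Coordinates in a parallel real frame and the kernel of the first entry *)

Section ParallelFrame.
Variables (R : realType) (q : {poly R[i]}) (U1 U2 : plane R -> R).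
Hypotheses (sU1 : smooth_on setT U1) (sU2 : smooth_on setT U2).
Variable sg : 'I_4 -> plane R -> 'cV[R[i]]_4.
Implicit Types (z p X : plane R) (v : 'cV[R[i]]_4) (x : 'rV[R]_4).

Local Notation H1 := (h1C U1).
Local Notation H2 := (h2C U2).

Definition comb z x : 'cV[R[i]]_4 := \sum_i (x 0 i)%:C *: sg i z.

Hypotheses (flat_sg : forall i, flat q U1 U2 (sg i))
  (smooth_sg : forall i, smooth_cV (sg i))
  (real_comb : forall z x, E_R U1 U2 z (comb z x))
  (comb_surj : forall z v, E_R U1 U2 z v -> exists x, comb z x = v)
  (comb_inj : forall z x, comb z x = 0 -> x = 0).

Lemma Re_sum n (a : 'I_n -> R) (c : 'I_n -> R[i]) :
  complex.Re (\sum_i (a i)%:C * c i) = \sum_i a i * complex.Re (c i).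
Proof.
rewrite raddf_sum; apply: eq_bigr => i _.
by case: (c i) => x y /=; rewrite mul0r subr0.
Qed.

Lemma Im_sum n (a : 'I_n -> R) (c : 'I_n -> R[i]) :
  complex.Im (\sum_i (a i)%:C * c i) = \sum_i a i * complex.Im (c i).
Proof.
rewrite raddf_sum; apply: eq_bigr => i _.
by case: (c i) => x y /=; rewrite mul0r addr0.
Qed.

Lemma combE z x j : comb z x j 0 = \sum_i (x 0 i)%:C * sg i z j 0.
Proof. by rewrite summxE; apply: eq_bigr => i _; rewrite mxE. Qed.

(** The real linear map from R^4 to C with values [c i] on the standard basis, as a matrix acting on
    row vectors from the right. *)
Definition ReIm (c : 'I_4 -> R[i]) : 'M[R]_(4, 2) :=
  \matrix_(i, k) if k == 0 then complex.Re (c i) else complex.Im (c i).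

Lemma mul_ReIm x c : x *m ReIm c =
  \row_k (if k == 0 then complex.Re (\sum_i (x 0 i)%:C * c i)
          else complex.Im (\sum_i (x 0 i)%:C * c i)).
Proof.
apply/rowP => k; rewrite !mxE (Re_sum (x 0)) (Im_sum (x 0)).
by case: ifP => k0; apply: eq_bigr => i _; rewrite mxE k0.
Qed.

Lemma mul_ReIm_eq0 x c : x *m ReIm c = 0 <-> \sum_i (x 0 i)%:C * c i = 0.
Proof.
rewrite mul_ReIm; split=> [/rowP E|->]; last first.
  by apply/rowP => k; rewrite !mxE /= if_same.
apply/eqP; rewrite eq_complex; apply/andP; split; apply/eqP.
  by have := E 0; rewrite !mxE.
by have := E 1; rewrite !mxE.
Qed.

Definition fstmx z : 'M[R]_(4, 2) := ReIm (fun i => sg i z k0 0).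

Lemma fstmxP z x : x *m fstmx z = 0 <-> comb z x k0 0 = 0.
Proof. by rewrite mul_ReIm_eq0 combE. Qed.

(** A real vector may have any first entry, and by [comb_surj] it is the value at [z] of some
    combination of the frame. *)
Lemma fstmx_full z : row_full (fstmx z).
Proof.
rewrite -sub1mx; apply/row_subP => k; set u := row k _.
have [x xE] := comb_surj (realv_E_R U1 U2 z (u 0 0 +i* u 0 1) 0).
have -> : u = x *m fstmx z; last exact: submxMl.
rewrite mul_ReIm -combE xE realvE; apply/rowP => j; rewrite mxE /=.
case: eqP => [->//|j0]; congr (u 0 _); apply/val_inj => /=.
by case: j j0 => [[|[|//]] lt2] j0 //; case: j0; apply/val_inj.
Qed.

Lemma smooth_fstmx i k : smooth_on setT (fun z => fstmx z i k : R^o).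
Proof.
have [sr si] := smooth_sg i k0.
have [k0'|k0'] := eqVneq k 0.
  by rewrite (_ : (fun z => _) = fun z => complex.Re (sg i z k0 0))//;
    apply/funext => z; rewrite mxE k0'.
by rewrite (_ : (fun z => _) = fun z => complex.Im (sg i z k0 0))//;
  apply/funext => z; rewrite mxE (negbTE k0').
Qed.

Lemma conn0 X z : conn q U1 U2 X z 0 = 0.
Proof. by rewrite /conn !mulmx0 !scaler0 addr0. Qed.

Lemma conn_comb X z x :
  conn q U1 U2 X z (comb z x) = \sum_i (x 0 i)%:C *: conn q U1 U2 X z (sg i z).
Proof.
rewrite /comb; elim/big_rec2: _ => [|i y1 y2 _ <-]; first exact: conn0.
by rewrite conn_linear.
Qed.

Lemma dmx_fstmx p X : dmx fstmx p X =
  ReIm (fun i => - conn q U1 U2 X p (sg i p) k0 0).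
Proof.
apply/matrixP => i k; rewrite [LHS]mxE [RHS]mxE.
have [dr di] := flat_sg i X p k0.
case: ifP => k0'.
  rewrite -(@derive_val _ _ _ _ _ _ _ dr); congr ('D_X _ p).
  by apply/funext => z; rewrite mxE k0'.
rewrite -(@derive_val _ _ _ _ _ _ _ di); congr ('D_X _ p).
by apply/funext => z; rewrite mxE k0'.
Qed.

Lemma dmx_fstmx_inj p X x :
  x *m fstmx p = 0 -> x *m dmx fstmx p X = 0 -> x = 0 \/ X = 0.
Proof.
rewrite dmx_fstmx => /fstmxP v0 /mul_ReIm_eq0.
have -> : \sum_i (x 0 i)%:C * - conn q U1 U2 X p (sg i p) k0 0 =
    - conn q U1 U2 X p (comb p x) k0 0.
  rewrite conn_comb summxE -sumrN; apply: eq_bigr => i _.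
  by move: (conn _ _ _ _ _ _) => A; rewrite mxE mulrN.
have [-> _ _ _] := connE q sU1 sU2 X p (comb p x).
have vE := E_R_realv (real_comb p x).
have [v2 v1] := (E_RP U1 U2 p (comb p x)).1 (real_comb p x).
have h10 := h1_neq0 U1 p; have h20 := h2_neq0 U2 p.
(* Once the entry [k0] vanishes, reality makes [k2] vanish too, so only the dzbar term with the
   entry [k3] survives; that entry in turn determines [k1]. *)
rewrite v2 v0 [conjc 0]rmorph0 !mulr0 addr0 mulr0 add0r => /eqP.
rewrite oppr_eq0 !mulf_eq0 conjc_eq0 invr_eq0 (negbTE h10) (negbTE h20) !orFb.
move=> /orP[/eqP Z0|/eqP v3]; [right|left].
  by case: X Z0 => a b /eqP; rewrite eq_complex /= => /andP[/eqP -> /eqP ->].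
apply: (@comb_inj p); rewrite vE v0 v1 v3 [conjc 0]rmorph0 mulr0.
apply/colP; elim/ord4_ind; rewrite [RHS]mxE realvE//.
  by rewrite [conjc 0]rmorph0 mulr0.
by rewrite [conjc 0]rmorph0 mulr0.
Qed.

Definition ommx z : 'M[R]_4 := \matrix_(i, j) complex.Im (om (sg i z) (sg j z)).

Lemma om_comb z x (w : 'cV[R[i]]_4) :
  om (comb z x) w = \sum_i (x 0 i)%:C * om (sg i z) w.
Proof.
rewrite /comb; elim/big_rec2: _ => [|i y1 y2 _ <-].
  by rewrite /om !mxE !mul0r subrr addr0.
by rewrite om_linear.
Qed.

Lemma mul_ommx z x j : (x *m ommx z) 0 j = complex.Im (om (comb z x) (sg j z)).
Proof.
by rewrite om_comb Im_sum mxE; apply: eq_bigr => i _; rewrite mxE.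
Qed.

Lemma ommx_const z z1 : ommx z = ommx z1.
Proof.
apply/matrixP => i j; rewrite !mxE.
by rewrite (om_flat sU1 sU2 (flat_sg i) (flat_sg j) z z1).
Qed.

Lemma real_sg z i : E_R U1 U2 z (sg i z).
Proof.
rewrite (_ : sg i z = comb z (delta_mx 0 i))//.
rewrite /comb (bigD1 i)//= big1 ?addr0 => [|j ji]; rewrite mxE !eqxx.
  by rewrite rmorph1 scale1r.
by rewrite (negbTE ji) rmorph0 scale0r.
Qed.

Lemma omC v (w : 'cV[R[i]]_4) : om v w = - om w v.
Proof. by rewrite /om; ring. Qed.

(* om is purely imaginary on real vectors, so its imaginary part is still
   nondegenerate. *)
Lemma ommx_unit z : ommx z \in unitmx.
Proof.
suff inj x : x *m ommx z = 0 -> x = 0.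
  rewrite -row_free_unit -kermx_eq0; apply/eqP/row_matrixP => i.
  by rewrite row0; apply: inj; rewrite -row_mul mulmx_ker row0.
move=> x0; apply: (@comb_inj z); apply: (@om_nondeg _ U1 U2 z) => w /comb_surj[y <-].
rewrite omC om_comb big1 ?oppr0// => j _.
apply/eqP; rewrite mulf_eq0 omC oppr_eq0; apply/orP; right.
have := conj_om (real_comb z x) (real_sg z j).
have := mul_ommx z x j; rewrite x0 mxE; case: (om _ _) => a b /= <-.
move=> /eqP; rewrite eq_complex /= => /andP[/eqP aN _].
by rewrite eq_complex /= eqxx andbT; apply/eqP; lra.
Qed.

(* As om is constant, the coordinates of S_z x are those of the row
   om (S_z x) (sg_j z) times the constant matrix (om (sg_i 0) (sg_j 0))^-1; for
   real vectors with vanishing first entry, the real structure makes that row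
   linear in the last entries of the sg_j. *)
Definition frow (c : plane R -> 'I_4 -> R) z : 'rV[R]_4 :=
  (\row_j c z j) *m (2 *: invmx (ommx 0)).

Lemma smooth_frow c : (forall j, smooth_on setT (fun z => c z j : R^o)) ->
  smooth_rV_on setT (frow c).
Proof.
move=> sc k; set G := 2 *: invmx (ommx 0).
rewrite (_ : (fun z => _) = fun z => \sum_j c z j * G j k).
  exact: smooth_on_sum.
by apply/funext => z; rewrite mxE; apply: eq_bigr => j _; rewrite mxE.
Qed.

Definition frame1 := frow (fun z j => complex.Im (sg j z k3 0)).
Definition frame2 := frow (fun z j => complex.Re (sg j z k3 0)).

Lemma comb_realv z x (a b : R) : comb z x = realv U1 U2 z 0 (a +i* b) ->
  x = a *: frame1 z + b *: frame2 z.
Proof.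
move=> xE; rewrite -[LHS](mulmxK (ommx_unit z)) (ommx_const z 0).
(* With c = a + ib and w the entry [k3] of [sg j z], the pairing is cw minus its conjugate, so its
   imaginary part is 2 Im(cw) = 2 (a Im w + b Re w). This explains the factor 2 and the choice of
   the two frames. *)
have -> : x *m ommx 0 = 2 *: (a *: (\row_j complex.Im (sg j z k3 0)) +
    b *: (\row_j complex.Re (sg j z k3 0))).
  apply/rowP => j; rewrite (ommx_const 0 z) mul_ommx xE !mxE /om !realvE.
  have [s2 s1] := (E_RP U1 U2 z (sg j z)).1 (real_sg z j).
  rewrite s1 [conjc 0]rmorph0 mulr0 !mul0r subrr add0r.
  rewrite mulrACA mulVf ?h2_neq0// mul1r -conjcM.
  by case: (sg j z k3 0) => c d /=; ring.
by rewrite /frame1 /frame2 /frow -!scalemxAr -!scalemxAl mulmxDl -!scalemxAl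
  !scalerDr !scalerA ![2 * _]mulrC.
Qed.

Lemma ker_fstmx z x : x *m fstmx z = 0 <->
  exists a b : R, x = a *: frame1 z + b *: frame2 z.
Proof.
rewrite fstmxP; split=> [x0|[a [b ->]]].
  have [a [b cE]] : exists a b : R, comb z x k1 0 = a +i* b.
    by case: (comb z x k1 0) => a b; exists a, b.
  by exists a, b; apply: comb_realv; rewrite -cE -x0; exact: E_R_realv (real_comb z x).
(* For the converse, the coordinates [y] of the real vector with first entries 0 and a + ib are
   identified with the given combination by [comb_realv]. *)
have [y yE] := comb_surj (realv_E_R U1 U2 z 0 (a +i* b)).
by rewrite -(comb_realv yE) yE realvE.
Qed.

Lemma fstmx_convex :
  immersion (kerGr fstmx_full) /\ convex_map (kerGr fstmx_full).
Proof.
apply: (@kerGr_convex _ _ frame1 frame2).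
- exact: smooth_fstmx.
- by apply: smooth_frow => j; have [_ si] := smooth_sg j k3.
- by apply: smooth_frow => j; have [sr _] := smooth_sg j k3.
- exact: ker_fstmx.
- exact: dmx_fstmx_inj.
Qed.

End ParallelFrame.

(** * Parallel transport identified with the kernel bundle *)

Theorem proposition4p2 (R : realType) (q : {poly R[i]})
    (U1 U2 : plane R -> R) (hU : toda_solution q U1 U2)
    (T : plane R -> 'cV[R[i]]_4 -> 'cV[R[i]]_4)
    (hT : parallel_transport q U1 U2 T)
    (psi : 'cV[R[i]]_4 -> 'rV[R]_4) (hpsi : identification U1 U2 psi) :
  exists f : plane R -> Gr2 R,
    (forall z, [set x | x \in val (f z)] =
               psi @` (T z @` span_u13 U2 z)) /\
    immersion f /\ convex_map f.
Proof.
have [[sU1 sU2] _ _ _ _] := hU.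
have [[_ psi_inj psi_surj] psi_lin] := hpsi.
have thr z v : E_R U1 U2 z v -> exists2 s, flat q U1 U2 s & s z = v.
  by move=> /hT[s [ps sz _]]; exists s => //; exact: parallel_flat.
have ER0 : E_R U1 U2 0 0 by apply/E_RP; rewrite !mxE [conjc 0]rmorph0 !mulr0.
have psi0 : psi 0 = 0.
  have := psi_lin 1 0 0 ER0 ER0; rewrite scaler0 addr0 scale1r => /eqP.
  by rewrite -subr_eq0 opprD addrA subrr sub0r oppr_eq0 => /eqP.
(* The frame consists of parallel sections whose values at 0 correspond under [psi] to the standard
   basis. *)
have /choice[sg sgP] (i : 'I_4) : exists s,
    [/\ parallel q U1 U2 s, E_R U1 U2 0 (s 0) & psi (s 0) = delta_mx 0 i].
  have [v Ev vi] := psi_surj (delta_mx 0 i) I.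
  by have [s [ps s0 _]] := hT 0 v Ev; exists s; rewrite s0.
have fsg i : flat q U1 U2 (sg i) by apply: parallel_flat; have [] := sgP i.
have fcomb x : flat q U1 U2 (fun z => comb sg z x) by exact: flat_sum.
have [comb0 psi_comb] : (forall x, E_R U1 U2 0 (comb sg 0 x)) /\
    (forall x, psi (comb sg 0 x) = x).
  (* Both claims go through one induction on the sum, because [psi] is linear only on real
     vectors. *)
  suff P x : E_R U1 U2 0 (comb sg 0 x) /\ psi (comb sg 0 x) = x.
    by split=> x; have [] := P x.
  rewrite {3}(row_sum_delta x) /comb.
  elim/big_rec2: _ => [//|i y1 y2 _ [Ey yE]].
  have [_ Es sE] := sgP i; split; first exact: E_R_linear.
  by rewrite psi_lin// sE yE.
have rcomb z x : E_R U1 U2 z (comb sg z x).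
  exact: (flat_E_R sU1 sU2 thr (fcomb x) (comb0 x)).
(* The section chosen by [T] agrees with the combination of the frame at [z], hence also at 0. *)
have psi_T z x : psi (T z (comb sg z x)) = x.
  have [s [ps sz ->]] := hT z _ (rcomb z x).
  by rewrite (flat_eq sU1 sU2 thr (parallel_flat ps) (fcomb x) sz) psi_comb.
have scomb z v : E_R U1 U2 z v -> exists x, comb sg z x = v.
  move=> Ev; have [s fs sz] := thr z v Ev.
  have Es0 : E_R U1 U2 0 (s 0) by apply: (flat_E_R sU1 sU2 thr fs (z := z)); rewrite sz.
  (* The coordinates of [v] are read off at 0 from the flat section through it. *)
  exists (psi (s 0)); rewrite -sz.
  apply: (flat_eq sU1 sU2 thr (fcomb _) fs (z := 0)).
  by apply: psi_inj; rewrite ?inE//; exact: psi_comb.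
have icomb z x : comb sg z x = 0 -> x = 0.
  move=> x0; rewrite -(psi_comb x).
  by rewrite (flat_eq0 sU1 sU2 thr (fcomb x) x0).
exists (kerGr (fstmx_full scomb)); split; last first.
  apply: (fstmx_convex sU1 sU2 fsg) => //.
  by move=> i; have [[]] := sgP i.
move=> z; apply/seteqP; split=> [x /=|_ [_ [v /span_u13P-/(_ U1)[Ev v0] <-] <-]].
  rewrite mem_kerv => /eqP/fstmxP x0.
  exists (T z (comb sg z x)) => //; exists (comb sg z x) => //.
  by apply/(@span_u13P _ U1); split.
have [x xE] := scomb z v Ev; rewrite -xE psi_T /=.
by rewrite (mem_kerGr (fstmx_full scomb)); apply/eqP/fstmxP; rewrite xE.
Qed.
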